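(* Let $\{\sigma(\varepsilon)\}$ be a family of finite-dimensional density matrices (all of the same size), depending on a real parameter $\varepsilon$, that is analytic at $\varepsilon=0$. Let $F[\sigma(0),\sigma(\varepsilon)]$ denote the fidelity between $\sigma(0)$ and $\sigma(\varepsilon)$. Then $$F^{(1)}\equiv\frac{d}{d\varepsilon}F[\sigma(0),\sigma(\varepsilon)]\Big|_{\varepsilon=0}=0 .$$
   Context: A density matrix is a positive semidefinite Hermitian complex matrix of trace one. The fidelity between two density matrices $\rho,\eta$ of the same size is $F(\rho,\eta)=\left[\mathrm{tr}\sqrt{\sqrt{\rho}\,\eta\,\sqrt{\rho}}\right]^2$, where $\sqrt{\cdot}$ is the positive semidefinite square root. The family $\sigma(\varepsilon)$ is defined for real $\varepsilon$ in a neighbourhood of $0$; it is analytic at $\varepsilon=0$ if it is given near $\varepsilon=0$ by a convergent power series $\sigma(\varepsilon)=\sigma^{(0)}+\varepsilon\sigma^{(1)}+\varepsilon^2\sigma^{(2)}+\cdots$ with constant matrix coefficients. *)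

(* Defs.v *)
From mathcomp Require Import all_boot all_order all_algebra.
From mathcomp Require Import sesquilinear spectral.
From mathcomp Require Import all_classical all_reals all_analysis.
From mathcomp Require Import complex.

Set Implicit Arguments.
Unset Strict Implicit.
Unset Printing Implicit Defensive.

Import Order.TTheory GRing.Theory Num.Theory.
Import numFieldNormedType.Exports.

Local Open Scope classical_set_scope.
Local Open Scope ring_scope.
Local Open Scope complex_scope.
Local Open Scope sesquilinear_scope.

(* On R[i], [0 <= z] means that z is real and nonnegative. *)
Definition psdmx (C : numClosedFieldType) (n : nat) (A : 'M[C]_n) : Prop :=
  A \is hermsymmx /\ forall v : 'cV[C]_n, 0 <= (v ^t* *m A *m v) 0 0.

(* Well defined on positive semidefinite matrices, see [sqrtmxP] and
   [sqrtmx_uniq]; a junk value elsewhere. *)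
Definition sqrtmx (C : numClosedFieldType) (n : nat) (A : 'M[C]_n) : 'M[C]_n :=
  xget 0 [set B : 'M[C]_n | psdmx B /\ B *m B = A].

Definition density_matrix (C : numClosedFieldType) (n : nat) (A : 'M[C]_n) :
    Prop :=
  psdmx A /\ \tr A = 1.

(* The trace of a positive semidefinite matrix is real, so [Re] only changes
   its type from R[i] to R. *)
Definition fidelity (R : realType) (n : nat) (rho eta : 'M[R[i]]_n) : R :=
  (complex.Re (\tr (sqrtmx (sqrtmx rho *m eta *m sqrtmx rho)))) ^+ 2.

(* R[i] carries its usual topology through its alias R[i]^o. *)
Definition analytic_at0 (R : realType) (n : nat) (sigma : R -> 'M[R[i]]_n) :
    Prop :=
  exists s : nat -> 'M[R[i]]_n, \forall e \near (0 : R),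
    series (fun k => (e ^+ k)%:C *: s k : 'M[R[i]^o]_n) @ \oo
      --> (sigma e : 'M[R[i]^o]_n).

Section PsdSquareRoot.
Variables (C : numClosedFieldType) (n : nat).
Implicit Types A B : 'M[C]_n.

Lemma psdmx_spectral A : psdmx A ->
  A = (spectralmx A)^t* *m diag_mx (spectral_diag A) *m spectralmx A
  /\ forall i, 0 <= spectral_diag A 0 i.
Proof.
move=> [hA pA].
have uU := spectral_unitarymx A.
have /orthomx_spectralP := hermitian_normalmx hA.
rewrite (invmx_unitary uU) => eA; split=> // i.
have E : spectralmx A *m (spectralmx A)^t* = 1%:M by apply/unitarymxP.
have := pA ((row i (spectralmx A))^t*).
set U := spectralmx A in eA E *; set D := diag_mx _ in eA.
have H : U *m (row i U)^t* = delta_mx i 0.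
  apply/colP => j; move/matrixP: E => /(_ j i); rewrite !mxE eqxx andbT => <-.
  by apply: eq_bigr => k _; rewrite !mxE.
have H' : row i U *m U^t* = delta_mx 0 i.
  by apply/rowP => j; rewrite -row_mul E !mxE eq_sym.
rewrite trmxCK {1}eA !mulmxA H' -mulmxA H -rowE -colE.
by rewrite !mxE eqxx mulr1n.
Qed.

Lemma psdmx_diag (U : 'M[C]_n) (d : 'rV[C]_n) : (forall i, 0 <= d 0 i) ->
  psdmx (U^t* *m diag_mx d *m U).
Proof.
move=> d0; split.
  apply/is_hermitianmxP; rewrite expr0 scale1r !trmx_mul !map_mxM /= trmxCK.
  rewrite mulmxA; congr (_ *m _ *m _).
  rewrite tr_diag_mx map_diag_mx; congr diag_mx; apply/rowP => i.
  by rewrite !mxE; apply/esym/CrealP/ger0_real.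
move=> v; rewrite !mulmxA -mulmxA.
have -> : v^t* *m U^t* = (U *m v)^t* by rewrite trmx_mul map_mxM.
rewrite mxE sumr_ge0 // => i _; rewrite mul_mx_diag !mxE mulrAC.
by rewrite mulr_ge0 // -/(mulmx U v) mulrC mul_conjC_ge0.
Qed.

Lemma sqrtmx_exists A : psdmx A -> exists B, psdmx B /\ B *m B = A.
Proof.
move=> /psdmx_spectral[eA d0]; set U := spectralmx A in eA.
have E : U *m U^t* = 1%:M by apply/unitarymxP/spectral_unitarymx.
exists (U^t* *m diag_mx (map_mx sqrtC (spectral_diag A)) *m U); split.
  by apply: psdmx_diag => i; rewrite mxE sqrtC_ge0.
rewrite !mulmxA -(mulmxA _ U) E mulmx1 -(mulmxA (U^t*)) mulmx_diag.
rewrite [RHS]eA; congr (_ *m diag_mx _ *m _).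
by apply/rowP => i; rewrite !mxE -expr2 sqrtCK.
Qed.

Lemma sqrtmx_uniq A B : psdmx A -> psdmx B -> A *m A = B *m B -> A = B.
Proof.
move=> /psdmx_spectral[eA a0] /psdmx_spectral[eB b0].
have := spectral_unitarymx A; have := spectral_unitarymx B.
move: (spectral_diag A) (spectral_diag B) (spectralmx A) (spectralmx B)
  => a b U V in eA a0 eB b0 *.
move=> uV uU; have /unitarymxP EU := uU; have /unitarymxP EV := uV => eAB.
have EU' : U^t* *m U = 1%:M by rewrite -(invmx_unitary uU) mulVmx ?unitarymx_unit.
have EV' : V^t* *m V = 1%:M by rewrite -(invmx_unitary uV) mulVmx ?unitarymx_unit.
pose W := V *m U^t*.
have WA : V *m A *m U^t* = W *m diag_mx a.
  by rewrite eA /W !mulmxA -(mulmxA _ U) EU mulmx1.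
have WB : V *m B *m U^t* = diag_mx b *m W.
  by rewrite eB /W !mulmxA EV mul1mx.
have WAA : V *m (A *m A) *m U^t* = W *m diag_mx a *m diag_mx a.
  by rewrite -WA {2}eA !mulmxA -(mulmxA _ U) EU mulmx1.
have WBB : V *m (B *m B) *m U^t* = diag_mx b *m (diag_mx b *m W).
  by rewrite -WB {1}eB !mulmxA EV mul1mx.
have eW : V *m A *m U^t* = V *m B *m U^t*.
  rewrite WA WB; apply/matrixP => i j.
  have : (W *m diag_mx a *m diag_mx a) i j = (diag_mx b *m (diag_mx b *m W)) i j.
    by rewrite -WAA -WBB eAB.
  rewrite !(mul_mx_diag, mul_diag_mx) !mxE.
  rewrite -!/(W i j); set w := (\sum_k _).
  have [->|w0] := eqVneq w 0; first by rewrite mul0r mulr0.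
  move=> h; rewrite mulrC; congr (_ * _).
  apply/eqP; rewrite -(@eqrXn2 _ 2) //.
  apply/eqP; apply: (mulfI w0); rewrite !expr2.
  by rewrite mulrA h mulrCA mulrA mulrC.
by move: (congr1 (fun X => V^t* *m X *m U) eW);
   rewrite !mulmxA EV' !mul1mx -!mulmxA EU' !mulmx1.
Qed.

Lemma sqrtmxP A : psdmx A -> psdmx (sqrtmx A) /\ sqrtmx A *m sqrtmx A = A.
Proof.
move=> /sqrtmx_exists[B hB].
exact: (@xgetPex _ 0 [set B | psdmx B /\ B *m B = A] (ex_intro _ B hB)).
Qed.

End PsdSquareRoot.

(* Main.v *)
Require Import Defs.
From mathcomp Require Import all_boot all_order all_algebra.
From mathcomp Require Import sesquilinear spectral.
From mathcomp Require Import all_classical all_reals all_analysis.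
From mathcomp Require Import complex.
From mathcomp Require Import ring lra.
Import Order.TTheory GRing.Theory Num.Theory.
Import numFieldNormedType.Exports.
Local Open Scope classical_set_scope.
Local Open Scope ring_scope.

(* In an eigenbasis of rho = sigma(0), with eigenvalues r_i, write
   N = sqrt (sqrt rho * eta * sqrt rho) = rho + D.  The diagonal entries of N^2
   give, summing the last term over r_i <> 0 only,
     2 (1 - tr N) = sum_(r_i = 0) eta_ii + sum_i r_i^-1 sum_j |D_ij|^2,
   and tr (D (N^2 - rho^2)) = tr (D N D) + tr (D^2 rho) >= tr (D^2 rho) makes D
   Lipschitz in eta - rho.  For eta = sigma(e) the second term is thus O(e^2);
   the first is the trace of eta on the kernel of rho, which is nonnegative and
   vanishes at e = 0, so it is O(e^2) too.  Hence F = 1 + O(e^2). *)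

Set Implicit Arguments.
Unset Strict Implicit.

(** * Positive semidefinite matrices: traces and congruences *)

Section PsdMatrices.
Local Open Scope sesquilinear_scope.
Variable C : numClosedFieldType.

Lemma psdmx_conj n (A : 'M[C]_n) i j : psdmx A -> A j i = (A i j)^*.
Proof.
move=> [/is_hermitianmxP + _]; rewrite expr0 scale1r => {1}->.
by rewrite !mxE.
Qed.

Lemma mxtrace_mul_conj m n (X : 'M[C]_(m, n)) :
  \tr (X *m X^t*) = \sum_i \sum_j `|X i j| ^+ 2.
Proof.
by apply: eq_bigr => i _; rewrite mxE; apply: eq_bigr => j _;
   rewrite !mxE normCK.
Qed.

Lemma psdmx_congr m n (B : 'M[C]_(m, n)) (A : 'M[C]_n) :
  psdmx A -> psdmx (B *m A *m B^t*).
Proof.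
move=> [hA pA]; split.
  apply/is_hermitianmxP; rewrite expr0 scale1r !trmx_mul !map_mxM /= trmxCK.
  move/is_hermitianmxP: hA; rewrite expr0 scale1r => {1}->.
  by rewrite mulmxA.
move=> v; have := pA (B^t* *m v).
by rewrite trmx_mul map_mxM /= trmxCK !mulmxA.
Qed.

Lemma psdmx_diag_ge0 n (A : 'M[C]_n) i : psdmx A -> 0 <= A i i.
Proof.
move=> [_ /(_ (delta_mx i 0))].
rewrite trmx_delta -mulmxA -colE.
have -> : map_mx Num.conj (delta_mx 0 i : 'rV[C]_n) = delta_mx 0 i.
  by apply/matrixP => a b; rewrite !mxE conjC_nat.
by rewrite -rowE !mxE.
Qed.

Lemma psdmx_trace_ge0 n (A : 'M[C]_n) : psdmx A -> 0 <= \tr A.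
Proof. by move=> pA; apply: sumr_ge0 => i _; apply: psdmx_diag_ge0. Qed.

Lemma unitary_congr_frobenius n (U X : 'M[C]_n) : U \is unitarymx ->
  \sum_i \sum_j `|(U *m X *m U^t*) i j| ^+ 2 = \sum_i \sum_j `|X i j| ^+ 2.
Proof.
move=> uU; rewrite -!mxtrace_mul_conj !trmx_mul !map_mxM /= trmxCK !mulmxA.
have E : U^t* *m U = 1%:M by rewrite -(invmx_unitary uU) mulVmx ?unitarymx_unit.
by rewrite -(mulmxA _ (U^t*) U) E mulmx1 mxtrace_mulC !mulmxA E mul1mx.
Qed.

(** * The trace defect [1 - \tr N] for a diagonal state *)

Section DiagonalState.
Variables (n : nat) (r : 'rV[C]_n) (eta N : 'M[C]_n).
Hypothesis r_ge0 : forall i, 0 <= r 0 i.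
Hypothesis r_sum : \sum_i r 0 i = 1.
Hypothesis eta_trace : \tr eta = 1.
Hypothesis eta_psd : psdmx eta.
Hypothesis N_psd : psdmx N.
(** Entrywise form of $N^2=\sqrt\rho\,\eta\sqrt\rho$ with $\rho$ = [diag_mx r]. *)
Hypothesis N_sqr : forall i j,
  (N *m N) i j = sqrtC (r 0 i) * eta i j * sqrtC (r 0 j).

Let D := N - diag_mx r.
(* As 0^-1 = 0, only the nonzero eigenvalues contribute. *)
Let K := \sum_i (r 0 i)^-1.

(** As [N] is Hermitian, the left side is the diagonal entry $(N^2)_{ii}$. *)
Let sqr_norm_row i : \sum_k `|N i k| ^+ 2 = r 0 i * eta i i.
Proof.
rewrite -[in RHS](sqrtCK (r 0 i)) expr2 mulrAC -N_sqr mxE.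
by apply: eq_bigr => k _; rewrite (psdmx_conj i k N_psd) normCK.
Qed.

Let N_kernel i j : r 0 i = 0 -> N i j = 0.
Proof.
move=> r0; have := sqr_norm_row i; rewrite r0 mul0r => /eqP.
rewrite psumr_eq0; last by move=> k _; rewrite exprn_ge0.
by move=> /allP /(_ j); rewrite mem_index_enum sqrf_eq0 normr_eq0 => /(_ isT)/eqP.
Qed.

Let D_conj i j : D j i = (D i j)^*.
Proof.
rewrite !mxE (psdmx_conj i j N_psd) rmorphB rmorphMn /=; congr (_ - _).
rewrite eq_sym; case: eqP => [->|//].
by rewrite !mulr1n; apply/esym/CrealP/ger0_real.
Qed.

Let D_kernel i j : r 0 j = 0 -> D i j = 0.
Proof.
move=> r0; rewrite D_conj !mxE N_kernel // r0 mul0rn subr0.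
by rewrite conjC0.
Qed.

(** Substituting $N=\rho+D$ in [sqr_norm_row] gives $\sum_j|D_{ij}|^2=r_i(\eta_{ii}-2N_{ii}+r_i)$.
    Dividing by $r_i\neq0$ and summing produces the three traces, except that $\mathrm{tr}\,\eta$
    misses the $\eta_{ii}$ with $r_i=0$. *)
Lemma trace_defect_diag : 2 * (1 - \tr N) =
  \sum_(i | r 0 i == 0) eta i i + \sum_i (r 0 i)^-1 * \sum_j `|D i j| ^+ 2.
Proof.
have row i : \sum_j `|N i j| ^+ 2 =
    \sum_j `|D i j| ^+ 2 + r 0 i * (2 * N i i - r 0 i).
  rewrite (bigD1 i) //= [in RHS](bigD1 i) //=.
  rewrite (eq_bigr (fun j => `|D i j| ^+ 2)); last first.
    by move=> j ji; rewrite !mxE eq_sym (negPf ji) mulr0n subr0.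
  have Nr : N i i \is Num.real by apply/ger0_real/psdmx_diag_ge0.
  have Dr : D i i \is Num.real.
    by rewrite !mxE eqxx mulr1n rpredB // ger0_real.
  by rewrite !real_normK // !mxE eqxx mulr1n; ring.
have -> : \sum_i (r 0 i)^-1 * \sum_j `|D i j| ^+ 2 =
    \sum_(i | r 0 i != 0) (eta i i - 2 * N i i + r 0 i).
  rewrite [RHS]big_mkcond; apply: eq_bigr => i _ /=.
  case: eqP => [->|/eqP r0] /=; first by rewrite invr0 mul0r.
  have -> : \sum_j `|D i j| ^+ 2 = r 0 i * (eta i i - 2 * N i i + r 0 i).
    by have := row i; rewrite sqr_norm_row => /eqP; rewrite -subr_eq => /eqP <-; ring.
  by rewrite mulKf.
have tN : \tr N = \sum_(i | r 0 i != 0) N i i.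
  rewrite /mxtrace (bigID (fun i => r 0 i == 0)) /= big1 ?add0r //.
  by move=> i /eqP /N_kernel.
have tr : 1 = \sum_(i | r 0 i != 0) r 0 i :> C.
  rewrite -r_sum (bigID (fun i => r 0 i == 0)) /= big1 ?add0r //.
  by move=> i /eqP.
have te : 1 = \sum_(i | r 0 i == 0) eta i i + \sum_(i | r 0 i != 0) eta i i :> C.
  by rewrite -eta_trace /mxtrace (bigID (fun i => r 0 i == 0)).
rewrite big_split sumrB /= -mulr_sumr -tN -tr addrA addrA -te; ring.
Qed.

Let r_le1 i : r 0 i <= 1.
Proof. by rewrite -r_sum (bigD1 i) //= lerDl sumr_ge0. Qed.

Let K_ge0 : 0 <= K.
Proof. by apply: sumr_ge0 => i _; rewrite invr_ge0. Qed.

Let rV_leK i : (r 0 i)^-1 <= K.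
Proof. by rewrite /K (bigD1 i) //= lerDl sumr_ge0 // => j _; rewrite invr_ge0. Qed.

(** Both sides are compared with $\mathrm{tr}(D(N^2-\rho^2))$. Dropping $\mathrm{tr}(DND)\ge0$
    bounds it below; above, the entries of $N^2-\rho^2$ are those of $\eta-\rho$ times
    $\sqrt{r_ir_j}\le1$. *)
Lemma frobenius_sqrt_le :
  \sum_i \sum_j `|D i j| ^+ 2 * r 0 j <=
  \sum_i \sum_j `|D i j| * `|(eta - diag_mx r) i j|.
Proof.
pose E := N *m N - diag_mx r *m diag_mx r.
(* This is $N^2-\rho^2=ND+D\rho$ multiplied by $D=D^*$. *)
have EE : D *m E = D *m N *m D^t* + D *m (D *m diag_mx r).
  have -> : D^t* = D by apply/matrixP => i j; rewrite mxE mxE -D_conj.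
  rewrite -mulmxA -mulmxDr /E /D; congr (_ *m _).
  by rewrite mulmxBr mulmxBl addrA subrK.
have t2 : \tr (D *m (D *m diag_mx r)) = \sum_i \sum_j `|D i j| ^+ 2 * r 0 j.
  rewrite exchange_big; apply: eq_bigr => j _; rewrite mulmxA mul_mx_diag mxE mxE.
  by rewrite mulr_suml; apply: eq_bigr => i _; rewrite [D j i]D_conj normCK [_ * D i j]mulrC.
have tDE : \tr (D *m E) = \sum_i \sum_j D i j * E j i.
  by apply: eq_bigr => i _; rewrite mxE.
have Ele i j : `|E j i| <= `|(eta - diag_mx r) i j|.
  have -> : E j i = sqrtC (r 0 j) * (eta - diag_mx r) j i * sqrtC (r 0 i).
    have -> : E j i = (N *m N) j i - (diag_mx r *m diag_mx r) j i.
      by rewrite mxE; congr (_ + _); rewrite mxE.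
    rewrite N_sqr mulmx_diag !mxE mulrBr mulrBl; congr (_ - _).
    case: eqP => [->|]; last by rewrite !mulr0n mulr0 mul0r.
    by rewrite !mulr1n [RHS]mulrAC -[in RHS]expr2 sqrtCK.
  have -> : `|(eta - diag_mx r) i j| = `|(eta - diag_mx r) j i|.
    rewrite !mxE (psdmx_conj j i eta_psd) eq_sym.
    case: eqP => [->|_]; last by rewrite !subr0 norm_conjC.
    by rewrite -(psdmx_conj i i eta_psd).
  have s01 k : 0 <= sqrtC (r 0 k) <= 1.
    by rewrite sqrtC_ge0 r_ge0 -[X in _ <= X]sqrtC1 ler_sqrtC ?r_le1 ?nnegrE ?ler01.
  rewrite !normrM; move: (s01 i) (s01 j) => /andP[a0 a1] /andP[b0 b1].
  rewrite !(ger0_norm a0) !(ger0_norm b0) mulrAC ler_piMl //.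
  by rewrite mulr_ile1.
have main : \sum_i \sum_j `|D i j| ^+ 2 * r 0 j <= \tr (D *m E).
  by rewrite EE mxtraceD t2 lerDr psdmx_trace_ge0 //; apply: psdmx_congr.
apply: (le_trans main).
(* A nonnegative trace equals its modulus, so the triangle inequality applies. *)
have /ger0_norm <- : 0 <= \tr (D *m E).
  apply: le_trans main; apply: sumr_ge0 => i _; apply: sumr_ge0 => j _.
  by rewrite mulr_ge0 // exprn_ge0.
rewrite tDE; apply: (le_trans (ler_norm_sum _ _ _)); apply: ler_sum => i _.
apply: (le_trans (ler_norm_sum _ _ _)); apply: ler_sum => j _.
by rewrite normrM ler_wpM2l.
Qed.

(** Column $j$ of [D] vanishes if $r_j=0$, and otherwise $r_j^{-1}\le K$, so removing the weight
    $r_j$ costs a factor [K]. Then $2Kxy\le x^2+K^2y^2$ lets one copy of [S] be absorbed. *)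
Lemma frobenius_sqrt_lipschitz :
  \sum_i \sum_j `|D i j| ^+ 2 <=
  K ^+ 2 * \sum_i \sum_j `|(eta - diag_mx r) i j| ^+ 2.
Proof.
set S := \sum_i _; set T := \sum_i _.
have h1 : S <= K * \sum_i \sum_j `|D i j| ^+ 2 * r 0 j.
  rewrite mulr_sumr; apply: ler_sum => i _; rewrite mulr_sumr.
  apply: ler_sum => j _; have [r0|r0] := eqVneq (r 0 j) 0.
    by rewrite D_kernel // normr0 expr0n /= mul0r mulr0.
  rewrite mulrCA ler_peMr ?exprn_ge0 // -(mulVf r0).
  by rewrite ler_wpM2r.
have h2 : 2 * K * (\sum_i \sum_j `|D i j| * `|(eta - diag_mx r) i j|) <= S + K ^+ 2 * T.
  move: (K) K_ge0 => k k_ge0.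
  rewrite /S /T !mulr_sumr -big_split; apply: ler_sum => i _ /=.
  rewrite !mulr_sumr -big_split; apply: ler_sum => j _ /=.
  set x := `|D i j|; set y := `|(eta - diag_mx r) i j|.
  rewrite -subr_ge0 (_ : _ - _ = (x - k * y) ^+ 2); last by ring.
  apply: real_exprn_even_ge0 => //.
  by rewrite rpredB ?normr_real // rpredM ?normr_real // ger0_real.
have h3 : 2 * S <= S + K ^+ 2 * T.
  apply: le_trans h2; rewrite -mulrA ler_wpM2l //; apply: (le_trans h1).
  by rewrite ler_wpM2l // frobenius_sqrt_le.
by move: h3; rewrite mulr_natl mulr2n lerD2l.
Qed.

(** Both sums in [trace_defect_diag] are nonnegative. The weights $r_i^{-1}\le K$ and the Lipschitz
    constant $K^2$ combine to $K^3$; the factor 2 is given up. *)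
Lemma trace_defect_diag_bound : 0 <= 1 - \tr N <=
  \sum_(i | r 0 i == 0) eta i i +
  K ^+ 3 * \sum_i \sum_j `|(eta - diag_mx r) i j| ^+ 2.
Proof.
have a0 : 0 <= \sum_(i | r 0 i == 0) eta i i.
  by apply: sumr_ge0 => i _; apply: psdmx_diag_ge0.
have s0 i : 0 <= \sum_j `|D i j| ^+ 2 by apply: sumr_ge0 => j _; rewrite exprn_ge0.
have b0 : 0 <= \sum_i (r 0 i)^-1 * \sum_j `|D i j| ^+ 2.
  by apply: sumr_ge0 => i _; rewrite mulr_ge0 // invr_ge0.
have h0 : 0 <= 1 - \tr N.
  by rewrite -(pmulr_rge0 _ (ltr0n C 2)) trace_defect_diag addr_ge0.
rewrite h0 /=; apply: (@le_trans _ _ (2 * (1 - \tr N))).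
  by rewrite ler_peMl // ler1n.
rewrite trace_defect_diag lerD2l exprS -mulrA.
apply: (@le_trans _ _ (K * \sum_i \sum_j `|D i j| ^+ 2)).
  by rewrite mulr_sumr; apply: ler_sum => i _; rewrite ler_wpM2r.
by rewrite ler_wpM2l // frobenius_sqrt_lipschitz.
Qed.

End DiagonalState.

(** Traces and Frobenius norms are unitarily invariant, so an eigenbasis of [rho] reduces this to
    the diagonal case. [Q] is the projection onto the kernel of [rho]; [Q] and [K] are chosen before
    [eta], hence serve a whole family. *)
Lemma trace_defect_bound n (rho : 'M[C]_n) : density_matrix rho ->
  exists Q K, [/\ psdmx Q, \tr (Q *m rho) = 0, 0 <= K &
    forall eta, density_matrix eta ->
    0 <= 1 - \tr (sqrtmx (sqrtmx rho *m eta *m sqrtmx rho)) <=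
    \tr (Q *m eta) + K * \sum_i \sum_j `|(eta - rho) i j| ^+ 2].
Proof.
move=> [prho trho].
have [erho r_ge0] := psdmx_spectral prho.
have uU := spectral_unitarymx rho.
move: (spectralmx rho) (spectral_diag rho) => U r in erho r_ge0 uU.
have UU : U *m U^t* = 1%:M by apply/unitarymxP.
have UU' : U^t* *m U = 1%:M by rewrite -(invmx_unitary uU) mulVmx ?unitarymx_unit.
have conjK A : U *m (U^t* *m A *m U) *m U^t* = A.
  by rewrite !mulmxA UU mul1mx -mulmxA UU mulmx1.
have tr_conj A : \tr (U *m A *m U^t*) = \tr A.
  by rewrite mxtrace_mulC mulmxA UU' mul1mx.
have Urho : U *m rho *m U^t* = diag_mx r by rewrite erho conjK.
have r_sum : \sum_i r 0 i = 1 by rewrite -mxtrace_diag -Urho tr_conj.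
pose s := map_mx sqrtC r.
have psqrt : psdmx (U^t* *m diag_mx s *m U).
  by apply: psdmx_diag => i; rewrite mxE sqrtC_ge0.
have [psr sr2] := sqrtmxP prho.
(* Uniqueness of the square root gives its form in the eigenbasis. *)
have esqrt : sqrtmx rho = U^t* *m diag_mx s *m U.
  apply: sqrtmx_uniq => //; rewrite sr2 !mulmxA -(mulmxA _ U) UU mulmx1.
  rewrite -(mulmxA (U^t*)) mulmx_diag {1}erho; congr (_ *m diag_mx _ *m _).
  by apply/rowP => i; rewrite !mxE -expr2 sqrtCK.
pose q : 'rV[C]_n := \row_i (r 0 i == 0)%:R.
have tQ A : \tr (U^t* *m diag_mx q *m U *m A) =
    \sum_(i | r 0 i == 0) (U *m A *m U^t*) i i.
  rewrite -!mulmxA mxtrace_mulC -!mulmxA [RHS]big_mkcond mul_diag_mx.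
  apply: eq_bigr => i _; rewrite mxE mxE !mulmxA.
  by case: ifP => _; rewrite ?mul1r ?mul0r.
exists (U^t* *m diag_mx q *m U), ((\sum_i (r 0 i)^-1) ^+ 3); split.
- by apply: psdmx_diag => i; rewrite mxE ler0n.
- by rewrite tQ Urho big1 // => i /eqP r0; rewrite mxE eqxx r0.
- by rewrite exprn_ge0 // sumr_ge0 // => i _; rewrite invr_ge0.
move=> eta [peta teta].
have pM : psdmx (sqrtmx rho *m eta *m sqrtmx rho).
  have {2}-> : sqrtmx rho = (sqrtmx rho)^t*.
    by apply/matrixP => i j; rewrite 2!mxE -(psdmx_conj _ _ psr).
  exact: psdmx_congr.
have [pN N2] := sqrtmxP pM.
set N := sqrtmx _ in pN N2 *.
rewrite -(tr_conj N) tQ -(unitary_congr_frobenius (eta - rho) uU).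
rewrite mulmxBr mulmxBl Urho.
apply: trace_defect_diag_bound => //.
- by rewrite tr_conj.
- exact: psdmx_congr.
- exact: psdmx_congr.
move=> i j; have -> : U *m N *m U^t* *m (U *m N *m U^t*) =
    diag_mx s *m (U *m eta *m U^t*) *m diag_mx s.
  rewrite !mulmxA -(mulmxA _ (U^t*) U) UU' mulmx1 -(mulmxA U N N) N2 esqrt.
  by rewrite !mulmxA UU mul1mx -!mulmxA UU mulmx1.
by rewrite mul_mx_diag mul_diag_mx !mxE.
Qed.

End PsdMatrices.

(** * Scalar power series: second-order remainder *)

Local Open Scope complex_scope.

(** The sharper bound $2-2\cdot2^{-m}$ passes through the induction. *)
Lemma geometric_half_le2 (K : numFieldType) (q : K) m :
  0 <= q -> q <= 2^-1 -> \sum_(k < m) q ^+ k <= 2.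
Proof.
move=> q0 q2; have h : \sum_(k < m) q ^+ k <= 2 - 2 * 2^-1 ^+ m.
  elim: m => [|m IH]; first by rewrite big_ord0 expr0 mulr1 subrr.
  rewrite big_ord_recr /=; apply: le_trans (lerD IH (lerXn2r m _ _ q2)) _;
    rewrite ?nnegrE ?invr_ge0 //.
  rewrite exprS mulVKf ?pnatr_eq0 //.
  by rewrite le_eqVlt; apply/orP; left; apply/eqP; ring.
by apply: (le_trans h); rewrite gerBl mulr_ge0 // exprn_ge0 // invr_ge0.
Qed.

(** From index 2 on, the terms are at most $B(|e|/d)^k$, a geometric sequence of ratio at most
    $1/2$, so the remainder is at most $2B(|e|/d)^2$. *)
Lemma power_series_taylor1 (K : numFieldType) (a : nat -> K^o) (d B : K) :
  0 < d -> (forall k, `|a k| * d ^+ k <= B) ->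
  forall (e : K) (l : K^o), `|e| <= d / 2 ->
  series (fun k => e ^+ k *: a k : K^o) @ \oo --> l ->
  `|l - (a 0%N + e * a 1%N)| <= 2 * B / d ^+ 2 * `|e| ^+ 2.
Proof.
move=> d0 aB e l ed2 cl.
have q0 : 0 <= `|e| / d by rewrite divr_ge0 // ltW.
have q2 : `|e| / d <= 2^-1 by rewrite ler_pdivrMr // mulrC.
have B0 : 0 <= B by apply: le_trans (aB 0%N); rewrite mulr_ge0 // exprn_ge0 // ltW.
have part m : `|series (fun k => e ^+ k *: a k : K^o) m.+2 - (a 0%N + e * a 1%N)|
    <= 2 * B / d ^+ 2 * `|e| ^+ 2.
  rewrite /series /= big_mkord 2!big_ord_recl /= expr0 scale1r expr1.
  rewrite addrA -[e *: a 1%N]/(e * a 1%N) [X in X - _]addrC addrK.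
  apply: (le_trans (ler_norm_sum _ _ _)).
  apply: (@le_trans _ _ (\sum_(k < m) B * (`|e| / d) ^+ 2 * (`|e| / d) ^+ k)).
    apply: ler_sum => k _; rewrite -[_ *: _]/(_ * _) normrM normrX.
    rewrite -mulrA -exprD expr_div_n mulrCA ler_wpM2l ?exprn_ge0 //.
    by rewrite ler_pdivlMr ?exprn_gt0.
  rewrite -mulr_sumr; apply: (@le_trans _ _ (B * (`|e| / d) ^+ 2 * 2)).
    rewrite ler_wpM2l ?geometric_half_le2 // mulr_ge0 // exprn_ge0 //.
  rewrite expr_div_n le_eqVlt; apply/orP; left; apply/eqP; field.
  by rewrite gt_eqF.
(* The bound on partial sums passes to the limit with an arbitrary slack [eps]. *)
apply/ler_addgt0Pr => eps eps0.
have [M _ hM] := cvgr_dist_le _ _ cl eps eps0.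
have := hM M.+2 (leqW (leqW (leqnn M))) => /= h.
rewrite -(subrK (series (fun k => e ^+ k *: a k : K^o) M.+2) l) -addrA addrC.
by apply: (le_trans (ler_normD _ _)); apply: lerD.
Qed.

(** The terms of a convergent series tend to 0, hence are bounded. *)
Lemma power_series_terms_bounded (K : numFieldType) (a : nat -> K^o) (d : K) :
  cvgn (series (fun k => d ^+ k *: a k : K^o)) ->
  exists2 B, 0 <= B & forall k, `|a k| * `|d| ^+ k <= B.
Proof.
move=> /cvg_series_cvg_0 h0.
have /cvg_seq_bounded/pinfty_ex_gt0[B B0 hB] : cvgn (fun k => d ^+ k *: a k : K^o).
  by apply/cvg_ex; exists 0.
exists B; first exact: ltW.
by move=> k; have /= := hB k I; rewrite -[_ *: _]/(_ * _) normrM normrX mulrC.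
Qed.

Lemma normc_real (R : rcfType) (e : R) : `|e%:C| = `|e|%:C.
Proof. by rewrite normc_def /= expr0n /= addr0 sqrtr_sqr. Qed.

(** * Entrywise first-order expansion of an analytic family *)

Section MatrixFamilies.
Variables (R : realType) (n : nat).

Lemma series_mx_coord (u : nat -> 'M[R[i]^o]_n) (l : 'M[R[i]^o]_n) i j :
  series u @ \oo --> l -> series (fun k => u k i j : R[i]^o) @ \oo --> (l i j : R[i]^o).
Proof.
move=> ul.
have -> : series (fun k => u k i j : R[i]^o) =
    (fun A : 'M[R[i]^o]_n => A i j) \o series u.
  by apply/funext => k; rewrite /series /= summxE.
exact: cvg_comp _ _ ul (@coord_continuous _ _ _ i j l).
Qed.

(** Convergence at one nonzero point bounds the terms of every entry, so [power_series_taylor1]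
    applies with one constant for all entries. *)
Lemma analytic_taylor1 (sigma : R -> 'M[R[i]]_n) : analytic_at0 sigma ->
  exists (s : 'M[R[i]]_n) (c : R[i]), 0 <= c /\ \forall e \near (0 : R),
  forall i j, `|(sigma e - sigma 0) i j - e%:C * s i j| <= c * `|e%:C| ^+ 2.
Proof.
move=> [s hs].
have /nbhs_ballP[d /= d0 hd] := hs.
(* A nonzero point inside the ball, where the series itself converges. *)
pose d' : R := d / 2.
have d'0 : 0 < d' by rewrite divr_gt0.
have coord e i j : ball (0 : R) d e ->
    series (fun k => e%:C ^+ k *: s k i j : R[i]^o) @ \oo --> (sigma e i j : R[i]^o).
  move=> /hd /(@series_mx_coord _ _ i j).
  set u := (X in series X @ _ --> _); set v := (X in _ -> series X @ _ --> _).
  suff -> : u = v by [].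
  by apply/funext => k; rewrite /u /v mxE rmorphXn.
have dd' : ball (0 : R) d d'.
  rewrite /ball /= sub0r normrN gtr0_norm // /d'.
  by rewrite ltr_pdivrMr // ltr_pMr // ltr1n.
have bnd (ij : 'I_n * 'I_n) : exists B, 0 <= B /\
    forall k, `|s k ij.1 ij.2| * `|d'%:C| ^+ k <= B.
  have [B B0 hB] := power_series_terms_bounded (cvgP _ (coord _ ij.1 ij.2 dd')).
  by exists B.
have {}bnd : exists2 B, 0 <= B & forall i j k, `|s k i j| * `|d'%:C| ^+ k <= B.
  have [B hB] := choice bnd.
  (* The sum of the finitely many bounds serves every entry. *)
  exists (\sum_ij B ij); first by apply: sumr_ge0 => ij _; case: (hB ij).
  move=> i j k; apply: le_trans (proj2 (hB (i, j)) k) _.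
  rewrite (bigD1 (i, j)) //= lerDl sumr_ge0 // => ij _; by case: (hB ij).
have {bnd} [B B0 hB] := bnd.
have dC0 : 0 < d'%:C by rewrite ltcR.
have est e i j : `|e| <= d' / 2 ->
    `|sigma e i j - (s 0%N i j + e%:C * s 1%N i j)|
      <= 2 * B / d'%:C ^+ 2 * `|e%:C| ^+ 2.
  move=> ed; apply: (@power_series_taylor1 _ (fun k => s k i j) d'%:C B dC0).
  - by move=> k; have := hB i j k; rewrite (ger0_norm (ltW dC0)).
  - rewrite normc_real.
    have half (x : R) : x%:C / 2 = (x / 2)%:C :> R[i].
      by rewrite rmorphM fmorphV rmorph_nat.
    rewrite half.
    by rewrite lecR.
  - apply: coord; rewrite /ball /= sub0r normrN; apply: le_lt_trans ed _.
    rewrite /d' -mulrA -invfM ltr_pdivrMr // ltr_pMr // -natrM ltr1n //.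
(* At [e = 0] the remainder bound is 0, which identifies the constant coefficient. *)
have s0 i j : sigma 0 i j = s 0%N i j.
  have := est 0 i j; rewrite normr0 ltW ?divr_gt0 // => /(_ isT).
  rewrite rmorph0 normr0 expr0n mulr0 mul0r addr0 normr_le0 subr_eq0.
  by move=> /eqP.
exists (s 1%N), (2 * B / d'%:C ^+ 2); split.
  by rewrite divr_ge0 ?mulr_ge0 ?exprn_ge0 ?(ltW dC0).
near=> e => i j; have := est e i j.
have -> : (sigma e - sigma 0) i j = sigma e i j - s 0%N i j by rewrite !mxE s0.
rewrite opprD addrA; apply.
near: e; apply/nbhs_ballP; exists (d' / 2) => /=; first by rewrite divr_gt0.
by move=> e; rewrite /ball /= sub0r normrN => /ltW.
Unshelve. all: by end_near.
Qed.

End MatrixFamilies.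

(** * A trace inequality and a derivative criterion *)

Lemma norm_mxtrace_mul_le (K : numDomainType) n (A B : 'M[K]_n) b :
  (forall i j, `|B i j| <= b) ->
  `|\tr (A *m B)| <= (\sum_i \sum_j `|A i j|) * b.
Proof.
move=> hB; apply: (le_trans (ler_norm_sum _ _ _)).
rewrite mulr_suml; apply: ler_sum => i _; rewrite mxE mulr_suml.
apply: (le_trans (ler_norm_sum _ _ _)); apply: ler_sum => j _.
by rewrite normrM ler_wpM2l.
Qed.

(** The difference quotient at $h$ is at most $m|h|$ in modulus, which tends to 0. *)
Lemma is_derive0_quadratic (R : realType) (f : R -> R) (m d : R) : 0 < d ->
  (forall e, `|e| < d -> `|f e - f 0| <= m * e ^+ 2) ->
  is_derive (0 : R) (1 : R) f (0 : R).
Proof.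
move=> d0 hf.
have h : (fun h : R => h^-1 *: ((f \o shift 0) (h *: (1 : R)) - f 0)) @ 0^' --> (0 : R).
  apply: (@cvg_to_0_linear _ _ m d d0) => r /andP[r0 rd].
  rewrite /= addr0 -[r *: 1]/(r * 1) mulr1 -[_ *: _]/(_ * _) normrM normfV.
  rewrite ler_pdivrMl // mulrCA -expr2 real_normK ?num_real //.
  exact: hf.
apply: DeriveDef; first exact: cvgP h.
exact: cvg_lim h.
Qed.

(** * Quadratic trace defect along the family and the derivative of the fidelity *)

Section Fidelity.
Variables (R : realType) (n : nat) (sigma : R -> 'M[R[i]]_n).

(** In [trace_defect_bound] the Frobenius term is $O(e^2)$ because $\sigma(e)-\sigma(0)=O(e)$. The
    kernel term is nonnegative on both sides of 0 and vanishes there, so its linear part must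
    vanish; this uses the family at both [e] and [- e]. *)
Lemma trace_defect_quadratic :
  (\forall e \near (0 : R), density_matrix (sigma e)) -> analytic_at0 sigma ->
  exists m d : R, 0 < d /\ forall e, `|e| < d -> 0 <= 1 -
    \tr (sqrtmx (sqrtmx (sigma 0) *m sigma e *m sqrtmx (sigma 0))) <= (m * e ^+ 2)%:C.
Proof.
move=> dens an.
have [Q [K [pQ Q0 K0 hQ]]] := trace_defect_bound (nbhs_singleton dens).
have [s [c [c0 ts]]] := analytic_taylor1 an.
have /nbhs_ballP[d1 /= d1_gt0 hd1] := dens.
have /nbhs_ballP[d2 /= d2_gt0 hd2] := ts.
pose q := \sum_i \sum_j `|Q i j|.
pose L := \sum_i \sum_j (c + `|s i j|) ^+ 2.
have q0 : 0 <= q by do 2![apply: sumr_ge0 => ? _].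
have L0 : 0 <= L.
  by do 2![apply: sumr_ge0 => ? _]; rewrite exprn_ge0 // addr_ge0.
have normC2 (e : R) : `|e%:C| ^+ 2 = (e ^+ 2)%:C.
  by rewrite normc_real -rmorphXn /= real_normK ?num_real.
(* One [q * c] for each remainder at [e] and [- e], and [K * L] for the Frobenius term. *)
have M0 : 0 <= 2 * (q * c) + K * L by rewrite addr_ge0 // !mulr_ge0.
have /complex_realP[m eM] := ger0_real M0.
(* The radius is at most 1 so that $c|e|^2\le c|e|$ in the Frobenius term. *)
exists m, (Num.min (Num.min d1 d2) 1).
rewrite !lt_min d1_gt0 d2_gt0 ltr01; split=> // e.
rewrite !lt_min -andbA => /and3P[ed1 ed2 e1].
have ball_e d : `|e| < d -> ball (0 : R) d e by rewrite /ball /= sub0r normrN.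
have ball_Ne d : `|e| < d -> ball (0 : R) d (- e) by rewrite /ball /= sub0r opprK.
have de := hd1 _ (ball_e _ ed1); have te := hd2 _ (ball_e _ ed2).
have dNe := hd1 _ (ball_Ne _ ed1); have tNe := hd2 _ (ball_Ne _ ed2).
have /andP[-> h] /= := hQ _ de; apply: (le_trans h).
rewrite rmorphM /= -eM -normC2 mulrDl; apply: lerD; last first.
  rewrite -mulrA ler_wpM2l // mulr_suml; apply: ler_sum => i _.
  rewrite mulr_suml; apply: ler_sum => j _; rewrite -exprMn.
  apply: lerXn2r; rewrite ?nnegrE // ?mulr_ge0 ?addr_ge0 //.
  rewrite -[(sigma e - sigma 0) i j](subrK (e%:C * s i j)) mulrDl.
  apply: (le_trans (ler_normD _ _)); apply: lerD; last by rewrite normrM mulrC.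
  apply: (le_trans (te i j)); rewrite ler_wpM2l // expr2 ler_piMl //.
  by rewrite normc_real lecR ltW.
(* The first-order terms at e and -e cancel, and both traces are nonnegative. *)
have tr_ge0 eta : psdmx eta -> 0 <= \tr (Q *m eta).
  move=> peta; have [psQ eQ] := sqrtmxP pQ.
  (* By cyclicity the trace is that of the positive semidefinite $\sqrt Q\,\eta\sqrt Q$. *)
  rewrite -eQ -mulmxA mxtrace_mulC; apply: psdmx_trace_ge0.
  have {2}-> : sqrtmx Q = (sqrtmx Q)^t*%sesqui.
    by apply/matrixP => i j; rewrite 2!mxE -(psdmx_conj _ _ psQ).
  exact: psdmx_congr.
(* There is no constant term because $\mathrm{tr}(Q\sigma(0))=0$. *)
have tQ x : \tr (Q *m sigma x) =
    \tr (Q *m (sigma x - sigma 0 - x%:C *: s)) + x%:C * \tr (Q *m s).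
  by rewrite !mulmxBr -scalemxAr !raddfB /= mxtraceZ Q0 subr0 subrK.
have est x : (forall i j, `|(sigma x - sigma 0) i j - x%:C * s i j|
      <= c * `|x%:C| ^+ 2) ->
    `|\tr (Q *m (sigma x - sigma 0 - x%:C *: s))| <= q * (c * `|x%:C| ^+ 2).
  move=> hx; apply: norm_mxtrace_mul_le => i j.
  by have := hx i j; congr (`|_| <= _); rewrite [in RHS]mxE; congr (_ + _); rewrite 2!mxE.
apply: (@le_trans _ _ (\tr (Q *m sigma e) + \tr (Q *m sigma (- e)))).
  by rewrite lerDl tr_ge0 //; case: dNe.
have /ger0_norm <- : 0 <= \tr (Q *m sigma e) + \tr (Q *m sigma (- e)).
  by rewrite addr_ge0 // tr_ge0 //; [case: de|case: dNe].
rewrite [\tr (Q *m sigma e)]tQ [\tr (Q *m sigma (- e))]tQ.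
rewrite addrACA rmorphN mulNr subrr addr0 -rmorphN.
apply: (le_trans (ler_normD _ _)).
have Ne : `|(- e)%:C| = `|e%:C| by rewrite !normc_real normrN.
rewrite -mulrA mulr_natl mulr2n -mulrA; apply: lerD; first exact: est.
by have := est _ tNe; rewrite Ne.
Qed.

End Fidelity.

Unset Implicit Arguments.
Set Strict Implicit.

Theorem mainTheorem1 (R : realType) (n : nat) (sigma : R -> 'M[R[i]]_n)
    (sigma_density : \forall e \near (0 : R), density_matrix (sigma e))
    (sigma_analytic : analytic_at0 sigma) :
  is_derive (0 : R) (1 : R) (fun e : R => fidelity (sigma 0) (sigma e)) (0 : R).
Proof.
have [m [d [d0 hd]]] := trace_defect_quadratic sigma_density sigma_analytic.
have Re_bound e : `|e| < d -> 0 <= 1 - complex.Re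
    (\tr (sqrtmx (sqrtmx (sigma 0) *m sigma e *m sqrtmx (sigma 0)))) <= m * e ^+ 2.
  move=> /hd; move: (\tr _) => [x y].
  by rewrite !lecE /= => /andP[/andP[_ ->] /andP[_ ->]].
(* At [e = 0] the lower and upper bounds on the defect coincide. *)
have F0 : fidelity (sigma 0) (sigma 0) = 1.
  have := Re_bound 0; rewrite normr0 expr0n mulr0 => /(_ d0)/le_anti/esym/eqP.
  by rewrite subr_eq0 => /eqP; rewrite /fidelity => <-; rewrite expr1n.
have [e1 e1_gt0 e1P] : exists2 e1, 0 < e1 & forall e, `|e| < e1 -> `|m * e ^+ 2| <= 1.
  (* Here $|m||e|\le1$ and $|e|\le1$; adding 1 to $|m|$ avoids inverting 0. *)
  exists (Num.min 1 (`|m| + 1)^-1); first by rewrite lt_min ltr01 invr_gt0 ltr_wpDl.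
  move=> e; rewrite lt_min => /andP[le1 lem].
  rewrite normrM normrX expr2 mulrA.
  rewrite -[X in _ <= X]mulr1; apply: ler_pM => //; rewrite ?mulr_ge0 //; last exact: ltW.
  have m1 : 0 < `|m| + 1 by rewrite ltr_wpDl.
  rewrite -(mulfV (lt0r_neq0 m1)); apply: ler_pM => //; last exact: ltW.
  by rewrite lerDl.
(* With $x$ the real part of the trace, $1-x^2=(1-x)(1+x)\le2me^2$. The radius [e1] ensures
   $me^2\le1$, so $x\ge0$ and squaring does no harm. *)
apply: (@is_derive0_quadratic _ _ (2 * m) (Num.min d e1)).
  by rewrite lt_min d0.
move=> e; rewrite lt_min => /andP[ed ee]; rewrite F0 /fidelity.
have := Re_bound e ed; have := e1P e ee.
move: (complex.Re _) => x; rewrite ler_norml => /andP[_ h] /andP[x1 x2].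
rewrite ler_norml -mulrA; apply/andP; split; nra.
Qed.
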